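(* There is an absolute constant $C>0$ such that the following holds. Let $A$ be an $n\times n$ random matrix with i.i.d. entries $A_{ij}$ satisfying $\mathbb{E}A_{ij}=0$, $\mathbb{E}A_{ij}^2\le1$ and $|A_{ij}|\le\sqrt n/2$ almost surely. Let $\varepsilon\in(0,1/2]$. Then with probability at least $1-2\exp(-\varepsilon n)$ there exists $J\subset[n]$ with $|J|\le\varepsilon n$ such that $$\|A_{J^c}\|_{\infty\to2}\le C\sqrt{\ln(\varepsilon^{-1})}\, n.$$
   Context: For an $n\times n$ matrix $B$ and $S\subset[n]$, $B_S$ denotes the matrix obtained from $B$ by replacing by zero all entries in the columns with indices not in $S$ (so $B_{J^c}$ is $B$ with the columns indexed by $J$ zeroed out). $\|B\|_{\infty\to2}=\max_{x\neq0}\|Bx\|_2/\|x\|_\infty=\max_{x\in\{-1,1\}^n}\|Bx\|_2$. *)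

(* Defs.v *)
From HB Require Import structures.
From mathcomp Require Import all_boot all_order all_algebra.
From mathcomp Require Import all_classical all_reals all_analysis.
Set Implicit Arguments. Unset Strict Implicit. Unset Printing Implicit Defensive.
Import Order.TTheory GRing.Theory Num.Theory.
Local Open Scope classical_set_scope.
Local Open Scope ring_scope.

Definition colrestrict (R : pzRingType) (n : nat) (B : 'M[R]_n) (S : {set 'I_n}) : 'M[R]_n :=
  \matrix_(i, j) (if j \in S then B i j else 0).

Definition norm_inf2 (R : realType) (n : nat) (B : 'M[R]_n) : R :=
  \big[Num.max/0]_(s : {ffun 'I_n -> bool})
     Num.sqrt (\sum_(i < n) (\sum_(j < n) B i j * (if s j then 1 else -1)) ^+ 2).

Definition mutually_independent d (T : measurableType d) (R : realType)
  (P : probability T R) (I : finType) (X : I -> {RV P >-> R}) : Prop :=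
  forall (S : {set I}) (B : I -> set R), (forall i, measurable (B i)) ->
    P (\bigcap_(i in [set i | i \in S]) (X i @^-1` B i)) =
    (\prod_(i in S) P (X i @^-1` B i))%E.

Definition identically_distributed d (T : measurableType d) (R : realType)
  (P : probability T R) (I : Type) (X : I -> {RV P >-> R}) : Prop :=
  forall i k (B : set R), measurable B -> P (X i @^-1` B) = P (X k @^-1` B).

(* Main.v *)
Require Import Defs.
From HB Require Import structures.
From mathcomp Require Import all_boot all_order all_algebra.
From mathcomp Require Import all_classical all_reals all_analysis.
From mathcomp Require Import measurable_realfun ring lra.
Import Order.TTheory GRing.Theory Num.Theory.
Local Open Scope classical_set_scope.
Local Open Scope ring_scope.

(** Zero out, for every row and every dyadic range [n 2^-(l+1) < a^2 <= n 2^-l],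
the columns whose entry falls in that range whenever the row has many more such
entries than expected.  With threshold [e^3 E N + 2 (l + 1) ln (1/eps)] on the
count [N], independence gives [E exp (2 |J|) <= exp (eps n)], so [|J| <= eps n]
with probability at least [1 - exp (- eps n)], while the squared norm of each
row of [A_{J^c}] is deterministically at most a multiple of [ln (1/eps) n].

Since [J] depends on [A], one takes a union bound over all [4^n] pairs of a set
[J] and a sign vector [x].  No symmetry of the entries is needed because of the
self-normalized bound [E exp (u X - u^2 X^2) <= exp (u^2)] for centered [X] of
variance at most one: on the event that the rows of [A_{J^c}] have norm
[O(sqrt (ln (1/eps) n))], it makes each coordinate of [A_{J^c} x] subgaussian,
hence [E exp (c |A_{J^c} x|^2 / (ln (1/eps) n)) <= exp (O(n))], and Markov's
inequality absorbs the factor [4^n]. *)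

(** * Independence: from events to expectations of products *)

Section Independence.
Import HBNNSimple numFieldNormedType.Exports.

Lemma integral_indic_comp {d} {T : measurableType d} {R : realType}
    (P : probability T R) (X : T -> R) (B : set R) :
  measurable_fun setT X -> measurable B ->
  (\int[P]_w (\1_B (X w))%:E = P (X @^-1` B))%E.
Proof.
move=> mX mB; rewrite -[X @^-1` B]setIT -integral_indic//.
by rewrite -[X in measurable X]setTI; exact: mX.
Qed.

(* Simple-function approximation of [h] extends the hypothesis from indicators. *)
Lemma integral_mul_comp_indep {d} {T : measurableType d} {R : realType}
    (P : probability T R) (X Z : T -> R) (c : R) (h : R -> R) :
  measurable_fun setT X -> measurable_fun setT Z -> (forall w, 0 <= Z w) ->
  (forall B : set R, measurable B ->
    (\int[P]_w (\1_B (X w) * Z w)%:E = P (X @^-1` B) * c%:E)%E) ->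
  measurable_fun setT h -> (forall a, 0 <= h a) ->
  (\int[P]_w (h (X w) * Z w)%:E = (\int[P]_w (h (X w))%:E) * c%:E)%E.
Proof.
move=> mX mZ Z0 XZ mh h0.
have mh' : measurable_fun [set: R] (EFin \o h : R -> \bar R) by exact/measurable_EFinP.
pose f := nnsfun_approx measurableT mh'.
have fh (a : R) : (f k a : R) @[k --> \oo] --> (h a : R).
  have := @cvg_nnsfun_approx _ _ _ _ measurableT _ mh' (fun x _ => h0 x) a Logic.I.
  by move=> /fine_cvgP[_].
have mfX k : measurable_fun setT (fun w => f k (X w)).
  exact: (measurableT_comp _ mX).
have step k : (\int[P]_w (f k (X w) * Z w)%:E = (\int[P]_w (f k (X w))%:E) * c%:E)%E.
  have mF r : measurable_fun setT (fun w => \1_(f k @^-1` [set r]) (X w) : R).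
    by apply: (measurableT_comp _ mX).
  have F0 r w : 0 <= r * \1_(f k @^-1` [set r]) (X w) :> R.
    have := @nnfun_muleindic_ge0 _ _ _ (f k) r (X w).
    by rewrite -EFinM lee_fin.
  under eq_integral do rewrite fimfunE fsbig_finite//= mulr_suml -sumEFin.
  under [in RHS]eq_integral do rewrite fimfunE fsbig_finite//= -sumEFin.
  rewrite ge0_integral_sum//; last 2 first.
  - by move=> r; apply/measurable_EFinP; apply: measurable_funM => //; exact: measurable_funM.
  - by move=> r w _; rewrite lee_fin mulr_ge0.
  rewrite ge0_integral_sum//; last 2 first.
  - by move=> r; apply/measurable_EFinP; exact: measurable_funM.
  - by move=> r w _; rewrite lee_fin.
  rewrite ge0_sume_distrl; last by move=> r _; apply: integral_ge0 => w _; rewrite lee_fin.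
  rewrite !big_seq; apply: eq_bigr => r rf.
  have r0 : 0 <= r.
    by move: rf; rewrite in_fset_set// inE => -[a _ <-].
  under eq_integral do rewrite -mulrA EFinM.
  under [in RHS]eq_integral do rewrite EFinM.
  rewrite ge0_integralZl_EFin//; last 2 first.
  - by move=> w _; rewrite lee_fin mulr_ge0.
  - by apply/measurable_EFinP; exact: measurable_funM.
  rewrite ge0_integralZl_EFin//; last exact/measurable_EFinP.
  by rewrite XZ// integral_indic_comp// muleA.
have nd k1 k2 a : (k1 <= k2)%N -> f k1 a <= f k2 a.
  by move=> /(nd_nnsfun_approx measurableT mh')/lefP.
have c1 : (\int[P]_w (f k (X w) * Z w)%:E @[k --> \oo] --> \int[P]_w (h (X w) * Z w)%:E)%E.
  rewrite [X in _ --> X](_ : _ = \int[P]_w (limn (fun k => (f k (X w) * Z w)%:E)))%E; last first.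
    apply: eq_integral => w _; apply/esym/cvg_lim => //.
    by apply: cvg_EFin; [exact: nearW|exact: cvgMr_tmp].
  apply: cvg_monotone_convergence => //.
  - by move=> k; apply/measurable_EFinP; exact: measurable_funM.
  - by move=> k w _; rewrite lee_fin mulr_ge0.
  - by move=> w _ k1 k2 k12; rewrite lee_fin ler_wpM2r// nd.
have c2 : (\int[P]_w (f k (X w))%:E @[k --> \oo] --> \int[P]_w (h (X w))%:E)%E.
  rewrite [X in _ --> X](_ : _ = \int[P]_w (limn (fun k => (f k (X w))%:E)))%E; last first.
    apply: eq_integral => w _; apply/esym/cvg_lim => //.
    by apply: cvg_EFin; [exact: nearW|exact: fh].
  apply: cvg_monotone_convergence => //.
  - by move=> k; apply/measurable_EFinP.
  - by move=> k w _; rewrite lee_fin.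
  - by move=> w _ k1 k2 k12; rewrite lee_fin nd.
have c3 : (\int[P]_w (f k (X w) * Z w)%:E @[k --> \oo] --> (\int[P]_w (h (X w))%:E) * c%:E)%E.
  by under eq_fun do rewrite step; apply: cvgeZr.
exact: (cvg_unique _ c1 c3).
Qed.

(** The hypothesis on events is the case where every [g i] is an indicator; general factors are
    brought back one index at a time. *)
Lemma integral_prod_indep {d} {T : measurableType d} {R : realType}
    {P : probability T R} {I : finType} {X : I -> {RV P >-> R}}
    (g : I -> R -> R) (e : I -> R) :
  mutually_independent X ->
  (forall i, measurable_fun setT (g i)) -> (forall i a, 0 <= g i a) ->
  (forall i, (\int[P]_w (g i (X i w))%:E = (e i)%:E)%E) ->
  (\int[P]_w (\prod_i g i (X i w))%:E = (\prod_i e i)%:E)%E.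
Proof.
move=> indX.
(* Induction on the set of indices where [g i] is not yet an indicator. *)
have [s sP] : exists s : seq I, forall i, i \notin s ->
    exists2 B, measurable B & g i = \1_B.
  by exists (enum I) => i; rewrite mem_enum.
elim: s g e sP => [|i0 s IH] g e sP mg g0 ge.
  have {}sP i : exists B, measurable B /\ g i = \1_B.
    by have [B] := sP i isT; exists B.
  have [B BP] := choice sP.
  have mB i := (BP i).1.
  have gB i := (BP i).2.
  have mXB i : measurable (X i @^-1` B i).
    by rewrite -[X in measurable X]setTI; exact: measurable_funP.
  have := indX [set: I]%SET B mB.
  rewrite (_ : \bigcap_(i in _) _ = \bigcap_i (X i @^-1` B i)); last first.
    by apply: eq_bigcapl; split => // i _; rewrite /= inE.
  have prod1 w : \prod_i g i (X i w) = \1_(\bigcap_i (X i @^-1` B i)) w.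
    rewrite indicE; case: (boolP (w \in _)) => [|/negP wB].
      rewrite inE => wB; rewrite big1// => i _.
      by rewrite gB indicE mem_set//; exact: wB.
    have [i Bi] : exists i, ~ B i (X i w).
      by apply/existsNP => wB'; apply: wB; rewrite inE => i _; exact: wB'.
    by rewrite (bigD1 i)//= gB indicE memNset// mul0r.
  under eq_integral do rewrite prod1.
  move=> PX; transitivity (P (\bigcap_i (X i @^-1` B i))).
    rewrite integral_indic ?setIT//.
    by apply: fin_bigcap_measurable => // i _; exact: mXB.
  rewrite PX.
  rewrite -prodEFin; apply: eq_big => [i|i _]; first by rewrite inE.
  rewrite -ge; under eq_integral do rewrite gB.
  by rewrite integral_indic_comp.
(* With an indicator in place of [g i0] the induction hypothesis applies, which yields the premise
   of [integral_mul_comp_indep]. *)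
pose g' h i := if i == i0 then h else g i.
have mZ : measurable_fun setT (fun w => \prod_(i | i != i0) g i (X i w)).
  under eq_fun do rewrite -big_filter.
  by apply: measurable_prod => i _; exact: (measurableT_comp (mg i)).
under eq_integral do rewrite (bigD1 i0)//=.
rewrite (integral_mul_comp_indep _ (X i0) (fun w => \prod_(i | i != i0) g i (X i w))
  (\prod_(i | i != i0) e i))//.
- by rewrite ge -EFinM [in RHS](bigD1 i0).
- by move=> w; apply: prodr_ge0.
- move=> B mB.
  have mXB : measurable (X i0 @^-1` B).
    by rewrite -[X in measurable X]setTI; exact: measurable_funP.
  pose e' i := if i == i0 then fine (P (X i0 @^-1` B)) else e i.
  have := IH (g' \1_B) e'.
  under eq_integral do rewrite (bigD1 i0)//= {1}/g' eqxx.
  under eq_integral.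
    move=> w _; under eq_bigr do [rewrite /g' ifN//].
    over.
  move=> ->.
  + rewrite (bigD1 i0)//= /e' eqxx EFinM fineK//; last exact: fin_num_measure.
    by congr (_ * _%:E)%E; apply: eq_bigr => i /negPf ->.
  + move=> i; rewrite /g'; case: eqVneq => [_ _|ii0 si]; first by exists B.
    by apply: sP; rewrite inE negb_or ii0.
  + by move=> i; rewrite /g'; case: ifP => // _; exact: measurable_indic.
  + by move=> i a; rewrite /g'; case: ifP => // _.
  + move=> i; rewrite /g' /e'; case: eqVneq => // -> .
    by rewrite fineK ?fin_num_measure// integral_indic_comp.
Qed.
End Independence.

(** * Moment bounds for products, Markov's inequality, and the self-normalized exponential bound *)

Section ProductMoments.
Context {d} {T : measurableType d} {R : realType} {P : probability T R}.

Lemma integral_prod_indep_le {I : finType} {X : I -> {RV P >-> R}}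
    (g : I -> R -> R) (c : I -> R) :
  mutually_independent X ->
  (forall i, measurable_fun setT (g i)) -> (forall i a, 0 <= g i a) ->
  (forall i, (\int[P]_w (g i (X i w))%:E <= (c i)%:E)%E) ->
  (\int[P]_w (\prod_i g i (X i w))%:E <= (\prod_i c i)%:E)%E.
Proof.
move=> indX mg g0 gc.
have ig0 i : (0 <= \int[P]_w (g i (X i w))%:E)%E.
  by apply: integral_ge0 => w _; rewrite lee_fin.
have fin i : (\int[P]_w (g i (X i w))%:E)%E \is a fin_num.
  by rewrite ge0_fin_numE// (le_lt_trans (gc i))// ltry.
rewrite (integral_prod_indep g (fun i => fine (\int[P]_w (g i (X i w))%:E)%E))//.
  rewrite lee_fin; apply: ler_prod => i _; rewrite fine_ge0//=.
  by rewrite -lee_fin fineK.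
by move=> i; rewrite fineK.
Qed.

(** Both exponential moments of the proof are expanded into this shape, a nonnegative combination of
    products over the entries. *)
Lemma integral_sum_prod_indep_le {I F : finType} {X : I -> {RV P >-> R}}
    (b : F -> R) (g : F -> I -> R -> R) (c : F -> I -> R) :
  mutually_independent X -> (forall f, 0 <= b f) ->
  (forall f i, measurable_fun setT (g f i)) -> (forall f i a, 0 <= g f i a) ->
  (forall f i, (\int[P]_w (g f i (X i w))%:E <= (c f i)%:E)%E) ->
  (\int[P]_w (\sum_f b f * \prod_i g f i (X i w))%:E
    <= (\sum_f b f * \prod_i c f i)%:E)%E.
Proof.
move=> indX b0 mg g0 gc.
have mprod f : measurable_fun setT (fun w => \prod_i g f i (X i w)).
  by apply: measurable_prod => i _; exact: (measurableT_comp (mg f i)).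
have prod0 f w : 0 <= \prod_i g f i (X i w) by exact: prodr_ge0.
under eq_integral do rewrite -sumEFin.
rewrite ge0_integral_sum//; last 2 first.
- by move=> f; apply/measurable_EFinP; exact: measurable_funM.
- by move=> f w _; rewrite lee_fin mulr_ge0.
rewrite -sumEFin; apply: lee_sum => f _.
under eq_integral do rewrite EFinM.
rewrite ge0_integralZl_EFin//; last 2 first.
- by move=> w _; rewrite lee_fin.
- exact/measurable_EFinP.
by rewrite EFinM lee_wpmul2l ?lee_fin//; exact: integral_prod_indep_le.
Qed.

(** Markov's inequality. *)
Lemma prob_gt_le (f : T -> R) (B t : R) :
  measurable_fun setT f -> (forall w, 0 <= f w) -> 0 < t ->
  (\int[P]_w (f w)%:E <= B%:E)%E ->
  (P [set w | (t < f w)%R] <= (B / t)%:E)%E.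
Proof.
move=> mf f0 t0 fB.
have mS : measurable [set w | t < f w].
  rewrite -[X in measurable X]setTI.
  by rewrite (_ : [set w | _] = f @^-1` `]t, +oo[); [exact: mf|
    apply/seteqP; split => w; rewrite /= in_itv/= andbT].
rewrite EFinM lee_pdivlMr//.
apply: le_trans fB.
rewrite muleC -[X in P X]setIT -integral_indic// -ge0_integralZl_EFin//; last 2 first.
- exact/measurable_EFinP/measurable_indic.
- exact: ltW.
apply: ge0_le_integral => //.
- by move=> w _; rewrite mule_ge0 ?lee_fin// ltW.
- by apply/measurable_EFinP; apply: measurable_funM => //; exact: measurable_indic.
- exact/measurable_EFinP.
- move=> w _; rewrite lee_fin indicE; case: (boolP (w \in _)) => [|_].
    by rewrite inE/= mulr1 => /ltW.
  by rewrite mulr0.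
Qed.

(* From [e^u <= 1 / (1 - u)] and [(1 - y + y^2) (1 + y + y^2) >= 1]. *)
Lemma expR_self_normalized (y : R) : expR (y - y ^+ 2) <= 1 + y + y ^+ 2.
Proof.
have q1 : 0 < 1 - y + y ^+ 2 by nra.
have q2 : 0 < 1 + y + y ^+ 2 by nra.
have := expR_ge1Dx (- (y - y ^+ 2)).
rewrite expRN => h.
have {h} : expR (y - y ^+ 2) * (1 - y + y ^+ 2) <= 1.
  rewrite -ler_pdivlMl ?expR_gt0// mulr1; apply: le_trans h; lra.
have := expR_gt0 (y - y ^+ 2); nra.
Qed.

(** At [y = u X] the majorant [1 + y + y^2] integrates to at most [1 + u^2], because centering kills
    the linear term. *)
Lemma integral_expR_self_normalized (X : {RV P >-> R}) (u : R) :
  ('E_P[X] = 0)%E -> (\int[P]_w ((X w) ^+ 2)%:E <= 1)%E ->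
  (\int[P]_w (expR (u * X w - (u * X w) ^+ 2))%:E <= (expR (u ^+ 2))%:E)%E.
Proof.
rewrite expectation_def => EX EX2.
have mX2 : measurable_fun setT (fun w => X w ^+ 2) by exact: measurable_funX.
have iX2 : P.-integrable setT (fun w => (X w ^+ 2)%:E).
  apply/integrableP; split; first exact/measurable_EFinP.
  under eq_integral do rewrite gee0_abs ?lee_fin ?sqr_ge0//.
  exact: le_lt_trans EX2 (ltry _).
have i1 : P.-integrable setT (fun w => 1%:E : \bar R).
  exact: finite_measure_integrable_cst.
(* [X] is integrable since [|x| <= 1 + x^2]. *)
have iX : P.-integrable setT (fun w => (X w)%:E).
  apply: (le_integrable measurableT _ _ (integrableD measurableT i1 iX2)) => //.
    exact/measurable_EFinP.
  move=> w _; rewrite /= lee_fin.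
  have := sqr_ge0 (X w); rewrite -(real_normK (num_real (X w))) => q.
  rewrite [leRHS]ger0_norm ?addr_ge0//; have := sqr_ge0 (`|X w| - 1); nra.
have iuX : P.-integrable setT (fun w => (u%:E * (X w)%:E)%E) by exact: integrableZl.
have iuX2 : P.-integrable setT (fun w => ((u ^+ 2)%:E * (X w ^+ 2)%:E)%E) by exact: integrableZl.
apply: (@le_trans _ _ (\int[P]_w ((1%:E + u%:E * (X w)%:E) + (u ^+ 2)%:E * (X w ^+ 2)%:E))%E).
  apply: ge0_le_integral => //.
  - apply/measurable_EFinP; apply: measurableT_comp => //.
    apply: measurable_funB; first exact: measurable_funM.
    by apply: measurable_funX; exact: measurable_funM.
  - apply: emeasurable_funD; first apply: emeasurable_funD => //.
    + exact: measurable_int iuX.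
    + exact: measurable_int iuX2.
  - by move=> w _; rewrite -!EFinM -!EFinD lee_fin -exprMn expR_self_normalized.
rewrite integralD//; last exact: integrableD.
rewrite integralD// !integralZl// EX mule0 adde0 integral_cst//.
rewrite [X in (_ * X)%E]probability_setT mule1.
apply: (@le_trans _ _ (1 + (u ^+ 2)%:E * 1)%E).
  by rewrite leeD2l// lee_wpmul2l// lee_fin sqr_ge0.
by rewrite mule1 -EFinD lee_fin expR_ge1Dx.
Qed.

End ProductMoments.

(** * Dyadic levels and the removal of heavy columns, for a fixed matrix *)

Definition dyadic_level {R : realType} (n l : nat) (x : R) : bool :=
  (n%:R / 2 ^+ l.+1 < x ^+ 2) && (x ^+ 2 <= n%:R / 2 ^+ l).

(** A pair [p] is a row and a level. Only [n] levels are kept: entries below all of them have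
    squares at most [n / 2^n], hence add at most [n] to a row. *)
Definition level_count {R : realType} {n : nat} (a : 'I_n * 'I_n -> R)
  (p : 'I_n * 'I_n) : R := \sum_j (dyadic_level n p.2 (a (p.1, j)))%:R.

Section DyadicLevels.
Local Set Implicit Arguments.
Local Unset Strict Implicit.
Context {R : realType}.
Implicit Types (n l k : nat) (x : R).

Lemma dyadic_level_le n l k x :
  dyadic_level n l x -> dyadic_level n k x -> (l <= k)%N.
Proof.
move=> /andP[_ lx] /andP[xk _]; rewrite leqNgt; apply/negP => kl.
have := lt_le_trans xk lx; rewrite ltNge ler_wpM2l//.
by rewrite lef_pV2 ?posrE ?exprn_gt0// ler_weXn2l ?ler1n.
Qed.

Lemma dyadic_level_inj n l k x :
  dyadic_level n l x -> dyadic_level n k x -> l = k.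
Proof.
move=> lx kx; apply/eqP.
by rewrite eqn_leq (dyadic_level_le lx kx) (dyadic_level_le kx lx).
Qed.

Lemma sqr_le_dyadic n k x : x ^+ 2 <= n%:R ->
  x ^+ 2 <= n%:R / 2 ^+ k
    + \sum_(l < k) (dyadic_level n l x)%:R * (n%:R / 2 ^+ l).
Proof.
move=> xn.
have [xk|[l lx]] : x ^+ 2 <= n%:R / 2 ^+ k \/ exists l : 'I_k, dyadic_level n l x.
- elim: k => [|k [IH|[l lx]]]; first by left; rewrite expr0 divr1.
    have [xk|xk] := leP (x ^+ 2) (n%:R / 2 ^+ k.+1); first by left.
    by right; exists ord_max; rewrite /dyadic_level /= xk.
  by right; exists (widen_ord (leqnSn k) l).
- by rewrite ler_wpDr// sumr_ge0.
rewrite (bigD1 l)//= lx mul1r ler_wpDl ?mulr_ge0 ?invr_ge0 ?exprn_ge0//.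
by rewrite ler_wpDr ?(andP lx).2// sumr_ge0.
Qed.

Lemma dyadic_sum_le_sqr n k x :
  \sum_(l < k) (dyadic_level n l x)%:R * (n%:R / 2 ^+ l.+1) <= x ^+ 2.
Proof.
have [[l lx]|nl] := pselect (exists l : 'I_k, dyadic_level n l x); last first.
  rewrite big1 ?sqr_ge0// => l _; case: (boolP (dyadic_level n l x)) => lx.
    by exfalso; apply: nl; exists l.
  by rewrite mul0r.
rewrite (bigD1 l)//= lx mul1r big1 ?addr0 ?(ltW (andP lx).1)// => i il.
case: (boolP (dyadic_level n i x)) => ix; last by rewrite mul0r.
by rewrite (val_inj (dyadic_level_inj lx ix)) eqxx in il.
Qed.

(** The levels are disjoint, so the product is [1] or [z]. *)
Lemma prod_dyadic_level_le n (S : pred 'I_n) x (z : R) : 1 <= z ->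
  \prod_(l < n | S l) z ^+ dyadic_level n l x
    <= 1 + z * \sum_(l < n | S l) (dyadic_level n l x)%:R.
Proof.
move=> z1; have z0 : 0 <= z by exact: le_trans z1.
have [[l /andP[Sl lx]]|nl] := pselect (exists l : 'I_n, S l && dyadic_level n l x); last first.
  rewrite big1 ?ler_wpDr ?mulr_ge0 ?sumr_ge0// => l Sl.
  case: (boolP (dyadic_level n l x)) => lx; last by rewrite expr0.
  by exfalso; apply: nl; exists l; rewrite Sl.
rewrite (bigD1 l)//= [in leRHS](bigD1 l)//= lx expr1 big1 => [|i /andP[_ il]].
  rewrite mulr1 ler_wpDl// ler_peMr// ler_wpDr// sumr_ge0//.
case: (boolP (dyadic_level n i x)) => ix; last by rewrite expr0.
by rewrite (val_inj (dyadic_level_inj lx ix)) eqxx in il.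
Qed.

Lemma measurable_dyadic_level n l : measurable_fun setT (@dyadic_level R n l).
Proof.
apply: measurable_and.
  by apply: measurable_fun_ltr => //; exact: measurable_funX.
by apply: measurable_fun_ler => //; exact: measurable_funX.
Qed.

(** [J] collects the columns with an entry in a level that exceeds its threshold in that row.
    Outside [J] such levels are empty, and any other level of row [i] holds at most [t (i, l)]
    entries, each of square at most [n / 2^l]. *)
Lemma heavy_columns {n} (a t : 'I_n * 'I_n -> R) (m : R) :
  (forall p, 0 <= t p) -> (forall p, a p ^+ 2 <= n%:R) ->
  \prod_p (1 + expR (3 * level_count a p - t p)) <= expR (2 * m) ->
  exists J : {set 'I_n}, #|J|%:R <= m /\
    forall i, \sum_(j in ~: J) a (i, j) ^+ 2
      <= n%:R * (1 + \sum_(l < n) t (i, l) / 2 ^+ l).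
Proof.
move=> t0 an prodm.
pose J : {set 'I_n} := [set j | [exists p : 'I_n * 'I_n,
  dyadic_level n p.2 (a (p.1, j)) && (t p < level_count a p)]]%SET.
exists J; split.
  (* A pair above its threshold removes at most as many columns as its own count. *)
  have cardJ : #|J|%:R <= \sum_(p | t p < level_count a p) level_count a p.
    rewrite exchange_big/= -sum1_card natr_sum [leLHS]big_mkcond/=.
    apply: ler_sum => j _; case: ifPn => [|_]; last by rewrite sumr_ge0.
    rewrite inE => /existsP[p /andP[pj tp]].
    by rewrite (bigD1 p)//= pj ler_wpDr ?sumr_ge0.
  apply: le_trans cardJ _; rewrite -(@ler_pM2l _ 2)// -ler_expR.
  (* [expR (2 N)] is at most [1 + expR (3 N - t)] when [N > t]. *)
  apply: le_trans prodm; rewrite mulr_sumr expR_sum big_mkcond/=.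
  apply: ler_prod => p _; case: ifPn => tp; last by rewrite ler01 ler_wpDr ?expR_ge0.
  by rewrite expR_ge0 ler_wpDl// ler_expR; lra.
move=> i.
apply: (@le_trans _ _ (\sum_(j in ~: J) (n%:R / 2 ^+ n +
    \sum_(l < n) (dyadic_level n l (a (i, j)))%:R * (n%:R / 2 ^+ l)))).
  by apply: ler_sum => j _; exact: sqr_le_dyadic.
rewrite big_split/= mulrDr mulr1 lerD//.
  (* The entries below all levels: at most [n] of them, of square at most [n / 2^n], and
     [n < 2^n]. *)
  rewrite sumr_const -(mulr_natr (_ / _)) -mulrA ler_piMr// mulrC ler_pdivrMr ?exprn_gt0//.
  rewrite mul1r -natrX ler_nat (leq_trans (max_card _))// card_ord.
  exact/ltnW/ltn_expl.
rewrite exchange_big/= mulr_sumr; apply: ler_sum => l _.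
rewrite -mulr_suml [leRHS]mulrCA ler_wpM2r ?mulr_ge0 ?invr_ge0 ?exprn_ge0//.
have [tl|tl] := ltP (t (i, l)) (level_count a (i, l)); last first.
  apply: le_trans tl; rewrite [leLHS]big_mkcond/=; apply: ler_sum => j _.
  by case: ifP.
rewrite big1// => j; rewrite !inE => /existsPn/(_ (i, l)) /=.
by rewrite tl andbT => /negPf->.
Qed.

End DyadicLevels.

(** * Expectations and exponential moments of the level counts *)

Section LevelCounts.
Local Set Implicit Arguments.
Local Unset Strict Implicit.
Context {d} {T : measurableType d} {R : realType} {P : probability T R}.

Definition level_prob (n l : nat) (X : T -> R) : R :=
  fine (P (X @^-1` [set x | dyadic_level n l x])).

(** The expectation of [level_count], by linearity. *)
Definition level_mean {n} (X : 'I_n * 'I_n -> {RV P >-> R}) (p : 'I_n * 'I_n) : R :=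
  \sum_j level_prob n p.2 (X (p.1, j)).

Lemma level_prob_ge0 n l (X : T -> R) : 0 <= level_prob n l X.
Proof. exact: fine_ge0. Qed.

Lemma integral_dyadic_level n l (X : {RV P >-> R}) :
  (\int[P]_w ((dyadic_level n l (X w))%:R)%:E = (level_prob n l X)%:E)%E.
Proof.
have mB : measurable [set x : R | dyadic_level n l x].
  rewrite -[X in measurable X]setTI; exact: measurable_dyadic_level.
have mXB : measurable (X @^-1` [set x | dyadic_level n l x]).
  by rewrite -[X in measurable X]setTI; exact: measurable_funP.
rewrite fineK; last exact: fin_num_measure.
rewrite -integral_indic_comp//; apply: eq_integral => w _.
by rewrite indicE; congr ((nat_of_bool _)%:R%:E); apply/idP/idP; rewrite inE.
Qed.

Lemma measurable_dyadic_level_natr n l :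
  measurable_fun setT (fun x : R => (dyadic_level n l x)%:R : R).
Proof.
rewrite (_ : (fun x => _) = \1_[set x : R | dyadic_level n l x]).
  apply: measurable_indic; rewrite -[X in measurable X]setTI.
  exact: measurable_dyadic_level.
by apply/funext => x; rewrite indicE; congr (nat_of_bool _)%:R; apply/idP/idP; rewrite inE.
Qed.

(** This is [dyadic_sum_le_sqr] integrated: each level is weighted by its lower endpoint. *)
Lemma sum_level_prob_le n (X : {RV P >-> R}) :
  (\int[P]_w ((X w) ^+ 2)%:E <= 1)%E ->
  \sum_(l < n) level_prob n l X * (n%:R / 2 ^+ l.+1) <= 1.
Proof.
move=> EX2; rewrite -lee_fin; apply: le_trans EX2.
have mD (l : 'I_n) : measurable_fun setT (fun w => (dyadic_level n l (X w))%:R : R).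
  exact: (measurableT_comp (measurable_dyadic_level_natr n l)).
have c0 (l : 'I_n) : 0 <= n%:R / 2 ^+ l.+1 :> R by rewrite mulr_ge0 ?invr_ge0 ?exprn_ge0.
rewrite -sumEFin.
have intZ (l : 'I_n) : ((level_prob n l X * (n%:R / 2 ^+ l.+1))%:E =
    \int[P]_w ((n%:R / 2 ^+ l.+1)%:E * ((dyadic_level n l (X w))%:R)%:E))%E.
  rewrite ge0_integralZl_EFin//; last exact/measurable_EFinP.
  by rewrite integral_dyadic_level mulrC EFinM.
under eq_bigr do rewrite intZ.
rewrite -ge0_integral_sum//; last first.
  by move=> l; apply/measurable_EFinP; exact: measurable_funM.
apply: ge0_le_integral => //.
- by move=> w _; apply: sume_ge0 => l _; rewrite -EFinM lee_fin mulr_ge0.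
- by apply: emeasurable_sum => l; apply/measurable_EFinP; exact: measurable_funM.
- by apply/measurable_EFinP; exact: measurable_funX.
move=> w _; under eq_bigr do rewrite -EFinM mulrC.
by rewrite sumEFin lee_fin dyadic_sum_le_sqr.
Qed.

(** Keeps the part [expR 3 * level_mean] of the thresholds from adding more than a constant multiple
    of [n] to a squared row norm. *)
Lemma sum_level_mean_le n (X : 'I_n * 'I_n -> {RV P >-> R}) i :
  (forall p, (\int[P]_w ((X p w) ^+ 2)%:E <= 1)%E) ->
  \sum_(l < n) level_mean X (i, l) / 2 ^+ l <= 2.
Proof.
move=> X2; have n0 : 0 < n%:R :> R by rewrite ltr0n; exact: leq_ltn_trans (ltn_ord i).
rewrite -(@ler_pM2r _ (n%:R / 2)) ?divr_gt0// [leRHS]mulrCA divff// mulr1.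
rewrite mulr_suml.
under eq_bigr do rewrite /level_mean !mulr_suml.
rewrite exchange_big/=.
apply: (@le_trans _ _ (\sum_(j < n) 1)); last by rewrite sumr_const card_ord.
apply: ler_sum => j _; apply: le_trans (sum_level_prob_le n (X2 (i, j))).
apply: ler_sum => l _; rewrite -mulrA ler_wpM2l ?level_prob_ge0//.
by rewrite exprS invfM mulrCA (mulrC (2 ^- l)).
Qed.

(** Passes from products over entries, where independence applies, to products over row-level pairs,
    which index the counts. *)
Lemma prod_pair_exchange n (S : {set 'I_n * 'I_n}) (h : 'I_n * 'I_n -> 'I_n -> R) :
  \prod_ij \prod_(l < n | (ij.1, l) \in S) h ij l
    = \prod_(p in S) \prod_j h (p.1, j) p.2.
Proof.
transitivity (\prod_i \prod_j \prod_(l < n | (i, l) \in S) h (i, j) l).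
  by rewrite pair_bigA; apply: eq_bigr => -[i j] _.
under eq_bigr do rewrite exchange_big/=.
by rewrite pair_big_dep; apply: eq_big => [[i l]|[i l] _].
Qed.

(** The levels of one entry are dependent but mutually exclusive: the mean is at most [1 + z q],
    with [q] the total probability of the levels in [S], and [exp (z q)] factors over the levels. *)
Lemma integral_prod_dyadic_level_le n (S : pred 'I_n) (z : R) (X : {RV P >-> R}) :
  1 <= z ->
  (\int[P]_w (\prod_(l < n | S l) z ^+ dyadic_level n l (X w))%:E
    <= (\prod_(l < n | S l) expR (z * level_prob n l X))%:E)%E.
Proof.
move=> z1; have z0 : 0 <= z by exact: le_trans z1.
have mD (l : 'I_n) : measurable_fun setT (fun w => (dyadic_level n l (X w))%:R : R).
  exact: (measurableT_comp (measurable_dyadic_level_natr n l)).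
have mZ : measurable_fun setT
    (fun w => \sum_(l < n | S l) (dyadic_level n l (X w))%:R : R).
  by under eq_fun do rewrite -big_filter; exact: measurable_sum.
apply: (@le_trans _ _ (\int[P]_w (1%:E + z%:E *
    (\sum_(l < n | S l) (dyadic_level n l (X w))%:R)%:E))%E).
  apply: ge0_le_integral => //.
  - by move=> w _; rewrite lee_fin prodr_ge0// => l _; rewrite exprn_ge0.
  - apply/measurable_EFinP; under eq_fun do rewrite -big_filter.
    apply: measurable_prod => l _.
    rewrite (_ : (fun _ => _) = (fun w => 1 + (z - 1) * (dyadic_level n l (X w))%:R)).
      by apply: measurable_funD => //; exact: measurable_funM.
    apply/funext => w; case: (dyadic_level _ _ _); rewrite ?mulr1 ?mulr0 ?addr0//.
    by rewrite expr1 addrCA subrr addr0.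
  - apply: emeasurable_funD => //; apply: emeasurable_funM => //.
    exact/measurable_EFinP.
  - by move=> w _; rewrite -EFinM -EFinD lee_fin prod_dyadic_level_le.
rewrite ge0_integralD//; last 2 first.
- by move=> w _; rewrite -EFinM lee_fin mulr_ge0// sumr_ge0.
- by apply: emeasurable_funM => //; exact/measurable_EFinP.
rewrite integral_cst// [X in (_ * X)%E]probability_setT mule1.
rewrite ge0_integralZl_EFin//; last 2 first.
- by move=> w _; rewrite lee_fin sumr_ge0.
- exact/measurable_EFinP.
under eq_integral do rewrite -sumEFin -big_filter.
rewrite ge0_integral_sum//; last first.
  by move=> l; apply/measurable_EFinP.
rewrite big_filter; under eq_bigr do rewrite integral_dyadic_level.
rewrite sumEFin -EFinM -EFinD lee_fin -expR_sum -mulr_sumr.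
exact: expR_ge1Dx.
Qed.

(** Expanding the product over sets [S] of pairs leaves exponentials of counts, which split over the
    entries. The term [expR 3 * level_mean] in the threshold cancels their moment bound exactly, so
    only [s] survives. *)
Lemma integral_prod_level_count_le n (X : 'I_n * 'I_n -> {RV P >-> R})
    (s : 'I_n * 'I_n -> R) :
  mutually_independent X ->
  (\int[P]_w (\prod_p (1 + expR (3 * level_count (X^~ w) p
      - (expR 3 * level_mean X p + s p))))%:E
    <= (\prod_p (1 + expR (- s p)))%:E)%E.
Proof.
move=> indX; pose t p := expR 3 * level_mean X p + s p.
pose b (S : {set 'I_n * 'I_n}) : R := \prod_p (if p \in S then expR (- t p) else 1).
pose g (S : {set 'I_n * 'I_n}) (ij : 'I_n * 'I_n) (x : R) : R :=
  \prod_(l < n | (ij.1, l) \in S) expR 3 ^+ dyadic_level n l x.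
pose c (S : {set 'I_n * 'I_n}) (ij : 'I_n * 'I_n) : R :=
  \prod_(l < n | (ij.1, l) \in S) expR (expR 3 * level_prob n l (X ij)).
have -> : (fun w => (\prod_p (1 + expR (3 * level_count (X^~ w) p
      - (expR 3 * level_mean X p + s p))))%:E) =
    (fun w => (\sum_S b S * \prod_ij g S ij (X ij w))%:E).
  apply/funext => w; congr EFin.
  under eq_bigr do rewrite addrC.
  rewrite bigA_distr; apply: eq_big => // S _.
  rewrite /b /g (prod_pair_exchange S (fun ij l => expR 3 ^+ dyadic_level n l (X ij w))).
  rewrite -!big_mkcond/= -big_split/=; apply: eq_bigr => p _.
  rewrite -/(t p) addrC expRD; congr (_ * _).
  rewrite /level_count mulr_sumr expR_sum; apply: eq_bigr => j _.
  by rewrite -expRM_natr.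
apply: le_trans (integral_sum_prod_indep_le b g c indX _ _ _ _) _.
- by move=> S; apply: prodr_ge0 => p _; case: ifP => // _; exact: expR_ge0.
- move=> S ij; rewrite /g; under eq_fun do rewrite -big_filter.
  apply: measurable_prod => l _.
  rewrite (_ : (fun _ => _) = (fun x : R => expR (3 * (dyadic_level n l x)%:R))).
    apply: measurableT_comp => //; apply: measurable_funM => //.
    exact: measurable_dyadic_level_natr.
  by apply/funext => x; rewrite mulrC -expRM_natl.
- by move=> S ij x; apply: prodr_ge0 => l _; rewrite exprn_ge0// expR_ge0.
- by move=> S ij; apply: integral_prod_dyadic_level_le; rewrite -expR0 ler_expR.
rewrite lee_fin; under [in leRHS]eq_bigr do rewrite addrC.
rewrite bigA_distr; apply: ler_sum => S _.
rewrite /b /c (prod_pair_exchange S (fun ij l => expR (expR 3 * level_prob n l (X ij)))).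
rewrite -!big_mkcond/= -big_split/=; apply: ler_prod => p _.
rewrite -expR_sum -mulr_sumr -expRD expR_ge0 ler_expR /t.
by rewrite /level_mean opprD addrAC addNr add0r lexx.
Qed.

End LevelCounts.

(** * Linearizing squares by a discrete mixture *)

Section GaussianMixture.
Local Set Implicit Arguments.
Local Unset Strict Implicit.
Context {R : realType}.

(* A discrete substitute for the Gaussian linearization [exp (s^2 / 2) = E exp (g s)]:
   the integer [k] nearest below [s] gives [s^2 / 8 - 1 / 8 <= k s / 4 - k^2 / 8]. *)
Definition slope {N} (v : R) (f : 'I_N * bool) : R :=
  (-1) ^+ f.2 * (f.1%:R / (4 * Num.sqrt v)).

(** The term [k^2 / 8] belongs to the linearization; the term with [kappa] pays for the quadratic
    correction in the self-normalized exponentials. *)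
Definition slope_weight {N} (kappa v : R) (f : 'I_N * bool) : R :=
  expR (- (f.1%:R ^+ 2 / 8) + slope v f ^+ 2 * kappa).

(** For rows of squared norm at most [kappa] it dominates the exponential of the sum of
    [Y_i^2 / (8 v) - 1 / 8], where [Y_i] is coordinate [i] of the image of [x]; unlike that
    exponential, it expands into products over entries. *)
Definition mixture {n} (N : nat) (kappa v : R) (x : 'I_n -> R)
    (a : 'I_n * 'I_n -> R) : R :=
  \prod_i \sum_(f : 'I_N * bool) slope_weight kappa v f *
    \prod_j expR (slope v f * x j * a (i, j) - (slope v f * x j * a (i, j)) ^+ 2).

Lemma sqr_slope N (v : R) (f : 'I_N * bool) : 0 < v ->
  slope v f ^+ 2 * v = f.1%:R ^+ 2 / 16.
Proof.
move=> v0; rewrite /slope exprMn sqrr_sign mul1r exprMn exprVn exprMn sqr_sqrtr ?ltW//.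
field; exact: lt0r_neq0.
Qed.

(** A single term suffices: [k s / 4 - k^2 / 8 = s^2 / 8 - (s - k)^2 / 8] with [s = |Y| / sqrt v]
    and [k] its integer part. *)
Lemma expR_sqr_le_mixture N (kappa v Y V : R) :
  0 < v -> V <= kappa -> `|Y| < N%:R * Num.sqrt v ->
  expR (Y ^+ 2 / (8 * v) - 8^-1) <=
    \sum_(f : 'I_N * bool) slope_weight kappa v f *
      expR (slope v f * Y - slope v f ^+ 2 * V).
Proof.
move=> v0 Vk YN; set r := Num.sqrt v.
have r0 : 0 < r by rewrite sqrtr_gt0.
have rv : r ^+ 2 = v by rewrite sqr_sqrtr// ltW.
pose s := `|Y| / r.
have s0 : 0 <= s by rewrite divr_ge0// ltW.
have sN : s < N%:R by rewrite ltr_pdivrMr.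
have /andP[ks sk] := truncn_itv s0.
set k := Num.truncn s in ks sk.
have kN : (k < N)%N by rewrite -(ltr_nat R); exact: le_lt_trans sN.
(* The sign bit makes [slope v f0 * Y] nonnegative. *)
pose f0 : 'I_N * bool := (Ordinal kN, Y < 0).
rewrite (bigD1 f0)//= ler_wpDr//.
  by apply: sumr_ge0 => f _; rewrite mulr_ge0 ?expR_ge0.
rewrite /slope_weight -expRD ler_expR.
have -> : slope v f0 * Y = k%:R * s / 4.
  rewrite /slope /f0 /= /s normrEsign -/r; have := lt0r_neq0 r0.
  by move=> ?; field.
have -> : Y ^+ 2 / (8 * v) = s ^+ 2 / 8.
  rewrite /s exprMn exprVn real_normK ?num_real// rv; field; exact: lt0r_neq0.
have h : slope v f0 ^+ 2 * V <= slope v f0 ^+ 2 * kappa.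
  by rewrite ler_wpM2l// sqr_ge0.
have sk1 : (s - k%:R) ^+ 2 <= 1.
  have h0 : 0 <= s - k%:R by rewrite subr_ge0.
  have h1 : s - k%:R <= 1 by rewrite lerBlDl -natr1 in sk *; exact: ltW.
  by rewrite expr_le1.
rewrite /=; nra.
Qed.

(** The choice [v = kappa + n] makes the total positive exponent [k^2 / 16], leaving
    [exp (- k^2 / 16) <= q^k]. Two signs and a geometric series of sum at most [17] give [34]. *)
Lemma sum_slope_weight_le n N (kappa v : R) : 0 < v -> v = kappa + n%:R ->
  \sum_(f : 'I_N * bool) slope_weight kappa v f * expR (slope v f ^+ 2) ^+ n <= 34.
Proof.
move=> v0 vk.
pose q : R := expR (- 16^-1).
have q0 : 0 < q by exact: expR_gt0.
(* From [exp (1 / 16) >= 17 / 16]. *)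
have q1 : q <= 16 / 17.
  rewrite /q expRN -(invf_div 17 16) lef_pV2 ?posrE ?expR_gt0 ?divr_gt0//.
  apply: le_trans (expR_ge1Dx _); lra.
apply: (@le_trans _ _ (\sum_(f : 'I_N * bool) q ^+ f.1)).
  apply: ler_sum => f _.
  rewrite /slope_weight -expRM_natr -expRD -addrA -mulrDr -vk sqr_slope//.
  rewrite /q -expRM_natr ler_expR.
  have : (f.1%:R : R) <= f.1%:R ^+ 2.
    by rewrite -natrX ler_nat; case: (nat_of_ord f.1) => // k; rewrite expnS leq_pmulr.
  lra.
rewrite -(pair_bigA _ (fun (k : 'I_N) (b : bool) => q ^+ k))/=.
under eq_bigr do rewrite sumr_const card_bool -mulr_natr.
rewrite -mulr_suml.
have := subrX1 q N; have : 0 <= q ^+ N by rewrite exprn_ge0// ltW.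
have : 0 <= \sum_(k < N) q ^+ k by apply: sumr_ge0 => k _; rewrite exprn_ge0// ltW.
nra.
Qed.

(** Multiply the rowwise lower bounds and compare exponents; the [n] copies of [1 / 8] become the
    [+ 1]. *)
Lemma sum_sqr_le_of_mixture n N (kappa v D : R) (x : 'I_n -> R) (a : 'I_n * 'I_n -> R) :
  0 < v ->
  (forall i, \sum_j (x j * a (i, j)) ^+ 2 <= kappa) ->
  (forall i, `|\sum_j x j * a (i, j)| < N%:R * Num.sqrt v) ->
  mixture N kappa v x a <= expR (D * n%:R) ->
  \sum_i (\sum_j x j * a (i, j)) ^+ 2 <= v * (8 * D + 1) * n%:R.
Proof.
move=> v0 Vk YN /(le_trans _) mixD.
have : expR (\sum_i ((\sum_j x j * a (i, j)) ^+ 2 / (8 * v) - 8^-1)) <= expR (D * n%:R).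
  apply: mixD; rewrite expR_sum; apply: ler_prod => i _; rewrite expR_ge0/=.
  apply: le_trans (expR_sqr_le_mixture v0 (Vk i) (YN i)) _.
  apply: ler_sum => f _; rewrite ler_wpM2l ?expR_ge0// -expR_sum ler_expR.
  rewrite !mulr_sumr -sumrB; apply: ler_sum => j _.
  by rewrite -exprMn mulrA.
rewrite ler_expR sumrB -mulr_suml sumr_const card_ord -(mulr_natr (8^-1)).
rewrite lerBlDr ler_pdivrMr ?mulr_gt0//; move/le_trans; apply.
by rewrite le_eqVlt; apply/orP; left; apply/eqP; field.
Qed.

End GaussianMixture.

(** * Expectation of the mixture, summed over a finite family of vectors *)

Section MixtureMean.
Local Set Implicit Arguments.
Local Unset Strict Implicit.
Context {d} {T : measurableType d} {R : realType} {P : probability T R}.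

Lemma integral_sum_mixture_le n N (kappa v : R) (C : finType) (x : C -> 'I_n -> R)
    (X : 'I_n * 'I_n -> {RV P >-> R}) :
  mutually_independent X ->
  (forall p, ('E_P[X p] = 0)%E) ->
  (forall p, (\int[P]_w ((X p w) ^+ 2)%:E <= 1)%E) ->
  (forall c j, x c j ^+ 2 <= 1) -> 0 < v -> v = kappa + n%:R ->
  (\int[P]_w (\sum_c mixture N kappa v (x c) (X^~ w))%:E
    <= (#|C|%:R * 34 ^+ n)%:E)%E.
Proof.
move=> indX EX EX2 x1 v0 vk.
(* An index is a vector of the family with a choice of slope and sign for every row. *)
pose K : finType := (C * {ffun 'I_n -> 'I_N * bool})%type.
pose b (k : K) : R := \prod_i slope_weight kappa v (k.2 i).
pose g (k : K) (ij : 'I_n * 'I_n) (y : R) : R :=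
  expR (slope v (k.2 ij.1) * x k.1 ij.2 * y - (slope v (k.2 ij.1) * x k.1 ij.2 * y) ^+ 2).
pose c (k : K) (ij : 'I_n * 'I_n) : R := expR (slope v (k.2 ij.1) ^+ 2).
have -> : (fun w => (\sum_c mixture N kappa v (x c) (X^~ w))%:E) =
    (fun w => (\sum_k b k * \prod_ij g k ij (X ij w))%:E).
  apply/funext => w; congr EFin.
  rewrite -(pair_bigA _ (fun cc phi => b (cc, phi) * \prod_ij g (cc, phi) ij (X ij w)))/=.
  apply: eq_bigr => cc _.
  rewrite /mixture bigA_distr_bigA; apply: eq_bigr => phi _.
  rewrite big_split/=; congr (_ * _).
  by rewrite pair_bigA; apply: eq_bigr => -[i j] _.
apply: le_trans (integral_sum_prod_indep_le b g c indX _ _ _ _) _.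
- by move=> k; apply: prodr_ge0 => i _; exact: expR_ge0.
- move=> k ij; apply: measurableT_comp => //.
  apply: measurable_funB; first exact: measurable_funM.
  by apply: measurable_funX; exact: measurable_funM.
- by move=> k ij y; exact: expR_ge0.
- move=> k ij; apply: le_trans (integral_expR_self_normalized _ _ (EX ij) (EX2 ij)) _.
  by rewrite lee_fin ler_expR exprMn ler_piMr// sqr_ge0.
rewrite lee_fin -(pair_bigA _ (fun cc phi => b (cc, phi) * \prod_ij c (cc, phi) ij))/=.
rewrite mulr_natl -sumr_const; apply: ler_sum => cc _.
apply: (@le_trans _ _ (\prod_(i < n) \sum_(f : 'I_N * bool)
    slope_weight kappa v f * expR (slope v f ^+ 2) ^+ n)).
  rewrite bigA_distr_bigA; apply: ler_sum => phi _.
  rewrite big_split/= /b /c ler_wpM2l ?prodr_ge0// => [i _|]; first exact: expR_ge0.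
  rewrite -(pair_bigA _ (fun i j => expR (slope v (phi i) ^+ 2)))/=.
  by apply: ler_prod => i _; rewrite prodr_const card_ord exprn_ge0 ?expR_ge0/=.
rewrite -[n in leRHS]card_ord -prodr_const; apply: ler_prod => i _.
rewrite sum_slope_weight_le// andbT; apply: sumr_ge0 => f _.
by rewrite mulr_ge0 ?exprn_ge0 ?expR_ge0.
Qed.

End MixtureMean.

(** * Sign vectors, numerical bounds, and the final assembly *)

Lemma norm_inf2_le {R : realType} {n} (B : 'M[R]_n) (b : R) : 0 <= b ->
  (forall s : {ffun 'I_n -> bool},
    \sum_(i < n) (\sum_(j < n) B i j * (if s j then 1 else -1)) ^+ 2 <= b ^+ 2) ->
  norm_inf2 B <= b.
Proof.
move=> b0 Bb; rewrite /norm_inf2; elim/big_ind: _ => [//|x y xb yb|s _].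
  by rewrite ge_max xb yb.
by rewrite -[leRHS]ger0_norm// -sqrtr_sqr ler_sqrt ?sqr_ge0.
Qed.

(** Removing columns is moved from the matrix to the vector, so that for a fixed pair the vector is
    deterministic and the matrix keeps all its independent entries. *)
Definition sign_vector {R : realType} {n} (c : {set 'I_n} * {ffun 'I_n -> bool})
  (j : 'I_n) : R := if j \in ~: c.1 then (if c.2 j then 1 else -1) else 0.

Lemma sqr_sign_vector {R : realType} {n} (c : {set 'I_n} * {ffun 'I_n -> bool}) j :
  sign_vector c j ^+ 2 = (j \in ~: c.1)%:R :> R.
Proof.
rewrite /sign_vector; case: ifP => _; last by rewrite expr0n.
by case: ifP => _; rewrite ?sqrrN expr1n.
Qed.

Lemma sum_geometric_arith {R : realType} (n : nat) :
  \sum_(l < n) l.+1%:R / 2 ^+ l = 4 - (n%:R + 2) * 2 / 2 ^+ n :> R.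
Proof.
elim: n => [|n IH]; first by rewrite big_ord0 expr0; field.
rewrite big_ord_recr/= IH exprS -natr1; field.
by rewrite expf_neq0.
Qed.

(** Each exponential is [eps^(2 (l + 1)) <= eps 2^-(l + 1)]; these sum to at most [eps] over the
    levels of each of the [n] rows. *)
Lemma prod_geometric_le {R : realType} (n : nat) (eps : R) :
  0 < eps -> eps <= 1 / 2 ->
  \prod_(p : 'I_n * 'I_n) (1 + expR (- (2 * ln eps^-1 * p.2.+1%:R)))
    <= expR (eps * n%:R).
Proof.
move=> e0 e2.
rewrite -(pair_bigA _ (fun (i l : 'I_n) => 1 + expR (- (2 * ln eps^-1 * l.+1%:R))))/=.
rewrite prodr_const card_ord expRM_natr.
apply: lerXn2r; rewrite ?nnegrE ?expR_ge0//.
  by apply: prodr_ge0 => l _; rewrite addr_ge0 ?expR_ge0.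
apply: (@le_trans _ _ (\prod_(l < n) expR (eps * 2^-1 ^+ l.+1))).
  apply: ler_prod => l _; rewrite addr_ge0 ?expR_ge0//=.
  apply: le_trans (expR_ge1Dx _); rewrite lerD2l.
  rewrite -mulNr expRM_natr -mulrN lnV ?posrE// opprK mulrC.
  rewrite expRM_natr lnK ?posrE//.
  apply: (@le_trans _ _ ((eps / 2) ^+ l.+1)).
    apply: lerXn2r; rewrite ?nnegrE ?sqr_ge0 ?divr_ge0 ?(ltW e0)//.
    by rewrite expr2 ler_wpM2l ?(ltW e0)//; lra.
  rewrite exprMn ler_wpM2r ?exprn_ge0 ?invr_ge0//.
  by rewrite exprS ler_piMr ?exprn_ile1 ?(ltW e0)//; lra.
rewrite -expR_sum ler_expR -mulr_sumr ler_piMr//; first exact: ltW.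
have -> : \sum_(l < n) 2^-1 ^+ l.+1 = 1 - 2^-1 ^+ n :> R.
  elim: n => [|n IH]; first by rewrite big_ord0 expr0 subrr.
  by rewrite big_ord_recr/= IH exprS; field.
by rewrite lerBlDr lerDl exprn_ge0.
Qed.

(** Lets additive constants be absorbed into multiples of [ln eps^-1]. *)
Lemma ln_inv_ge {R : realType} (eps : R) : 0 < eps -> eps <= 1 / 2 -> 1 / 2 <= ln eps^-1.
Proof.
move=> e0 e2; rewrite -ler_expR lnK ?posrE ?invr_gt0//.
have := expR_ge1Dx (- (1 / 2) : R).
rewrite expRN => h.
rewrite -[leLHS]invrK lef_pV2 ?posrE ?invr_gt0 ?expR_gt0//; lra.
Qed.

Lemma measurable_level_count {d} {T : measurableType d} {R : realType}
    {P : probability T R} {n} (X : 'I_n * 'I_n -> {RV P >-> R}) p :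
  measurable_fun setT (fun w => level_count (X^~ w) p).
Proof.
by apply: measurable_sum => j; exact: (measurableT_comp (measurable_dyadic_level_natr n p.2)).
Qed.

Lemma measurable_mixture {d} {T : measurableType d} {R : realType}
    {P : probability T R} {n} N (kappa v : R) (x : 'I_n -> R)
    (X : 'I_n * 'I_n -> {RV P >-> R}) :
  measurable_fun setT (fun w => mixture N kappa v x (X^~ w)).
Proof.
apply: measurable_prod => i _; apply: measurable_sum => f.
apply: measurable_funM => //; apply: measurable_prod => j _.
apply: measurableT_comp => //; apply: measurable_funB; first exact: measurable_funM.
by apply: measurable_funX; exact: measurable_funM.
Qed.

(** The deterministic content of the good event. Summing the mixture over all pairs plays the role
    of the union bound, since [J] is known only after [a]. *)
Lemma small_columns_norm {R : realType} {n : nat} (a t : 'I_n * 'I_n -> R)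
    (m kappa D : R) : (0 < n)%N -> 0 < kappa ->
  (forall p, 0 <= t p) -> (forall p, a p ^+ 2 <= n%:R) ->
  (forall i, n%:R * (1 + \sum_(l < n) t (i, l) / 2 ^+ l) <= kappa) ->
  \prod_p (1 + expR (3 * level_count a p - t p)) <= expR (2 * m) ->
  \sum_(c : {set 'I_n} * {ffun 'I_n -> bool})
    mixture n.+1 kappa (kappa + n%:R) (sign_vector c) a <= expR (D * n%:R) ->
  exists J : {set 'I_n}, #|J|%:R <= m /\
    forall b, 0 <= b -> (kappa + n%:R) * (8 * D + 1) * n%:R <= b ^+ 2 ->
      norm_inf2 (colrestrict (\matrix_(i, j) a (i, j)) (~: J)) <= b.
Proof.
move=> n0 k0 t0 an tk prodm mixD.
have [J [Jm Jrow]] := heavy_columns t0 an prodm.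
exists J; split => // b b0 bD; apply: norm_inf2_le => // s.
have v0 : 0 < kappa + n%:R by rewrite ltr_wpDr.
apply: le_trans bD.
have -> : \sum_i (\sum_j colrestrict (\matrix_(i0, j0) a (i0, j0)) (~: J) i j
      * (if s j then 1 else -1)) ^+ 2 =
    \sum_i (\sum_j sign_vector (J, s) j * a (i, j)) ^+ 2.
  apply: eq_bigr => i _; congr (_ ^+ 2); apply: eq_bigr => j _.
  rewrite !mxE /sign_vector /=; case: ifP => _; last by rewrite !mul0r.
  by rewrite mulrC.
apply: (sum_sqr_le_of_mixture (N := n.+1) (kappa := kappa)) => //.
- move=> i; apply: le_trans (tk i); apply: le_trans (Jrow i).
  rewrite [leRHS]big_mkcond/=; apply: ler_sum => j _.
  by rewrite exprMn sqr_sign_vector/=; case: ifP; rewrite ?mul1r ?mul0r.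
(* [N = n.+1] suffices: a row sum is at most [n sqrt n <= n sqrt v]. *)
- move=> i; apply: (@le_lt_trans _ _ (n%:R * Num.sqrt (kappa + n%:R))); last first.
    by rewrite ltr_pM2r ?sqrtr_gt0// ltr_nat.
  apply: le_trans (ler_norm_sum _ _ _) _.
  rewrite -[n in n%:R * _]card_ord mulr_natl -sumr_const; apply: ler_sum => j _.
  rewrite -sqrtr_sqr ler_sqrt ?(ltW v0)// exprMn sqr_sign_vector.
  apply: (@le_trans _ _ n%:R); last by rewrite lerDr ltW.
  apply: le_trans (an (i, j)); rewrite ler_piMl ?sqr_ge0//.
  by case: (_ \in _).
- apply: le_trans mixD; rewrite (bigD1 (J, s))//= lerDl; apply: sumr_ge0 => c _.
  apply: prodr_ge0 => i _; apply: sumr_ge0 => f _.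
  by rewrite mulr_ge0 ?expR_ge0// prodr_ge0// => j _; exact: expR_ge0.
Qed.

Theorem mainTheorem11 (R : realType) :
  exists C : R, 0 < C /\
  forall (n : nat) (d : measure_display) (T : measurableType d)
    (P : probability T R) (A : 'I_n * 'I_n -> {RV P >-> R}),
    mutually_independent A ->
    identically_distributed A ->
    (forall ij, ('E_P[A ij] = 0)%E) ->
    (forall ij, (\int[P]_w ((A ij w) ^+ 2)%:E <= 1)%E) ->
    (forall ij, {ae P, forall w, `|A ij w| <= Num.sqrt n%:R / 2}) ->
  forall eps : R, 0 < eps -> eps <= 1 / 2 ->
    exists E : set T, measurable E /\
      (E `<=` [set w | exists J : {set 'I_n},
          #|J|%:R <= eps * n%:R /\
          norm_inf2 (colrestrict (\matrix_(i, j) A (i, j) w) (~: J))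
            <= C * Num.sqrt (ln (eps^-1)) * n%:R]) /\
      ((1 - 2 * expR (- (eps * n%:R)))%:E <= P E)%E.
Proof.
(* Chosen so that [2 + 2 e^3 + 8 L <= C0 L] whenever [L >= 1 / 2]. *)
pose C0 : R := 12 + 4 * expR 3.
have C01 : 1 <= C0 by rewrite /C0; have := expR_ge0 (3 : R); lra.
(* Here [2 * 2] counts the [4^n] pairs and [34] is the mixture bound per row; the spare [1] in [D]
   leaves [exp (- n) <= exp (- eps n)]. *)
have [D D1 D136] : exists2 D : R, 1 <= D & 2 * 2 * 34 <= expR (D - 1).
  exists (1 + 2 * 2 * 34); first lra.
  by apply: le_trans (expR_ge1Dx _); lra.
pose c : R := 8 * D + 1.
have c1 : 1 <= c by rewrite /c; lra.
exists (c * C0); split; first by apply: mulr_gt0; lra.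
move=> n d T P A indA _ EA EA2 Abound eps e0 e2.
(* For [n = 0] the required probability is negative, so the empty event will do. *)
have [n_eq0|n0] := posnP n.
  exists set0; split => //; split => //.
  by rewrite measure0 lee_fin n_eq0 mulr0 oppr0 expR0; lra.
have n0R : 0 < n%:R :> R by rewrite ltr0n.
set L := ln eps^-1.
have L2 : 1 / 2 <= L by exact: ln_inv_ge.
pose t (p : 'I_n * 'I_n) := expR 3 * level_mean A p + 2 * L * p.2.+1%:R.
(* [2 * expR 3] comes from the level means, and [8 * L] from [2 L] times the sum of [(l + 1) / 2^l],
   at most [4]. *)
pose kappa := n%:R * (1 + 2 * expR 3 + 8 * L).
have e3 := expR_gt0 (3 : R).
have kappa0 : 0 < kappa by rewrite mulr_gt0//; lra.
have mean0 p : 0 <= level_mean A p by apply: sumr_ge0 => j _; exact: level_prob_ge0.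
have t0 p : 0 <= t p by rewrite addr_ge0// mulr_ge0//; lra.
have tk i : n%:R * (1 + \sum_(l < n) t (i, l) / 2 ^+ l) <= kappa.
  rewrite ler_wpM2l ?(ltW n0R)// -addrA lerD2l.
  under eq_bigr do rewrite /t mulrDl -!mulrA.
  rewrite big_split/= -!mulr_sumr sum_geometric_arith.
  have h1 := sum_level_mean_le i EA2.
  have h2 : 0 <= (n%:R + 2) * 2 / 2 ^+ n :> R.
    by rewrite divr_ge0 ?exprn_ge0// mulr_ge0// addr_ge0.
  nra.
pose Phi1 w := \prod_p (1 + expR (3 * level_count (A^~ w) p - t p)).
pose Phi2 w := \sum_(c : {set 'I_n} * {ffun 'I_n -> bool})
  mixture n.+1 kappa (kappa + n%:R) (sign_vector c) (A^~ w).
have mPhi1 : measurable_fun setT Phi1.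
  apply: measurable_prod => p _; apply: measurable_funD => //.
  apply: measurableT_comp => //; apply: measurable_funB => //.
  by apply: measurable_funM => //; exact: measurable_level_count.
have mPhi2 : measurable_fun setT Phi2.
  by apply: measurable_sum => c'; exact: measurable_mixture.
have Phi10 w : 0 <= Phi1 w by apply: prodr_ge0 => p _; rewrite addr_ge0 ?expR_ge0.
have Phi20 w : 0 <= Phi2 w.
  apply: sumr_ge0 => c' _; apply: prodr_ge0 => i _; apply: sumr_ge0 => f _.
  by rewrite mulr_ge0 ?expR_ge0// prodr_ge0// => j _; exact: expR_ge0.
pose F1 := [set w | expR (2 * (eps * n%:R)) < Phi1 w].
pose F2 := [set w | expR (D * n%:R) < Phi2 w].
have mgt (f : T -> R) (z : R) : measurable_fun setT f -> measurable [set w | z < f w].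
  move=> mf; rewrite -[X in measurable X]setTI.
  rewrite (_ : [set w | _] = f @^-1` `]z, +oo[); first exact: mf.
  by apply/seteqP; split => w; rewrite /= in_itv/= andbT.
have mF1 : measurable F1 by exact: mgt.
have mF2 : measurable F2 by exact: mgt.
(* The mean is at most [exp (eps n)] and the threshold is its square. *)
have PF1 : (P F1 <= (expR (- (eps * n%:R)))%:E)%E.
  apply: le_trans (prob_gt_le Phi1 _ _ mPhi1 Phi10 (expR_gt0 _)
    (integral_prod_level_count_le (fun p => 2 * L * p.2.+1%:R) indA)) _.
  rewrite lee_fin ler_pdivrMr ?expR_gt0// -expRD.
  apply: le_trans (prod_geometric_le n eps e0 e2) _.
  by rewrite ler_expR; lra.
have PF2 : (P F2 <= (expR (- (eps * n%:R)))%:E)%E.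
  apply: le_trans (prob_gt_le Phi2 _ _ mPhi2 Phi20 (expR_gt0 _)
    (integral_sum_mixture_le _ indA EA EA2 _ _ erefl)) _.
  - move=> c' j; rewrite sqr_sign_vector; by case: (_ \in _).
  - by rewrite addr_gt0.
  rewrite lee_fin ler_pdivrMr ?expR_gt0// -expRD card_prod card_ffun card_bool card_ord.
  rewrite -cardsT -powersetT card_powerset cardsT card_ord natrM !natrX -!exprMn.
  apply: (@le_trans _ _ (expR ((D - 1) * n%:R))).
    by rewrite expRM_natr lerXn2r ?nnegrE ?expR_ge0.
  rewrite ler_expR; nra.
(* [F3] is one null set outside which all the entry bounds hold together. *)
have [F3 [mF3 PF3 AF3]] := filter_forall (ae_filter_ringOfSetsType _) Abound.
exists (~` (F1 `|` F2 `|` F3)); split; first by apply: measurableC; do 2 apply: measurableU => //.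
split.
  move=> w /not_orP[/not_orP[nF1 nF2] nF3] /=.
  have Aw ij : `|A ij w| <= Num.sqrt n%:R / 2.
    by apply: contrapT => nA; apply/nF3/AF3 => /(_ ij).
  have an p : A p w ^+ 2 <= n%:R.
    rewrite -real_normK ?num_real//.
    apply: (@le_trans _ _ ((Num.sqrt n%:R / 2) ^+ 2)).
      by rewrite ler_sqr ?nnegrE ?divr_ge0 ?sqrtr_ge0.
    rewrite exprMn sqr_sqrtr ?(ltW n0R)//; nra.
  have Phi1w : Phi1 w <= expR (2 * (eps * n%:R)) by rewrite leNgt; apply/negP.
  have Phi2w : Phi2 w <= expR (D * n%:R) by rewrite leNgt; apply/negP.
  have [J [Jm Jn]] := small_columns_norm _ _ _ _ _ n0 kappa0 t0 an tk Phi1w Phi2w.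
  exists J; split => //; apply: Jn.
    have cC0 : 0 <= c * C0 by apply: mulr_ge0; lra.
    by apply: mulr_ge0 => //; apply: mulr_ge0 => //; exact: sqrtr_ge0.
  have L0 : 0 <= L by lra.
  have -> : (c * C0 * Num.sqrt L * n%:R) ^+ 2 = (c * C0) ^+ 2 * L * n%:R ^+ 2.
    by rewrite exprMn [(_ * Num.sqrt _) ^+ 2]exprMn sqr_sqrtr.
  have -> : (kappa + n%:R) * (8 * D + 1) * n%:R =
      c * (2 + 2 * expR 3 + 8 * L) * n%:R ^+ 2 by rewrite /kappa /c; ring.
  rewrite ler_wpM2r ?sqr_ge0//.
  have hC : 2 + 2 * expR 3 + 8 * L <= C0 * L.
    have : 0 <= expR 3 * (L - 1 / 2) by rewrite mulr_ge0 ?(ltW e3) ?subr_ge0.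
    rewrite /C0; lra.
  have c0 : 0 <= c by lra.
  (* With [c * C0 >= 1], the factor [c * C0] is at most its square, the one in the squared
     target. *)
  have cC01 : 1 <= c * C0 by rewrite mulr_ege1.
  apply: (@le_trans _ _ (c * C0 * L)); first by rewrite -mulrA ler_wpM2l.
  by rewrite ler_wpM2r// ler_eXnr.
have mF12 : measurable (F1 `|` F2) by exact: measurableU.
rewrite probability_setC; last exact: measurableU.
rewrite EFinB leeB//.
apply: le_trans (measureU2 P mF12 mF3) _.
rewrite [X in (_ + X)%E]PF3 adde0; apply: le_trans (measureU2 P mF1 mF2) _.
by rewrite mulr_natl mulr2n EFinD leeD.
Qed.
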